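(* Let $f:\mathbb{R}^d\to\mathbb{R}$ be a convex differentiable function whose gradient is $L$-Lipschitz, with minimizer $x^*$. Consider iterates $x_{t+1}=x_t-\gamma_t\bar g_t$ where $\bar g_t$ is a stochastic gradient at $x_t$, $g_t=\nabla f(x_t)$, and $\epsilon_t=\bar g_t-g_t$ has mean zero conditionally on the history $x_0,\dots,x_t$, with $\sigma_t^2=\mathbb{E}[|\epsilon_t|^2]$ and $\eta_t^4=\mathbb{E}[|\epsilon_t|^4]$; let $\bar\sigma^2=\frac1T\sum_t\sigma_t^2$ and $\bar\eta^4=\frac1T\sum_t\eta_t^4$ (assumed finite). Assume $0<\gamma_t\le\frac1L$ for all $t$, $|x_t-x^*|^2\le M^2$ for all $t$, and that the distribution of $\epsilon_t$ is symmetric for every $t$. Define $$S_T=\frac{1}{\gamma_T T}\cdot\frac{M^2}{2}+\frac{1}{2T}\sum_{t=1}^T\gamma_t\big(1+L\gamma_t\big)|\epsilon_t|^2-\frac1T\sum_{t=1}^T\epsilon_t\cdot\big(x_t-L\gamma_t^2g_t-x^*\big).$$ Then $$\mathrm{Var}(S_T)\le\frac1T\Big[4M^2\bar\sigma^2+\frac{\bar\eta^4}{L^2}\Big].$$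
   Context: $\bar g_t$ is the average of per-sample gradients over a randomly drawn mini-batch at $x_t$; the stochastic errors at different times are independent. Expectations and variances of $S_T$ are taken with respect to the stochastic errors $\epsilon_1,\dots,\epsilon_T$ (iterated, conditionally on the history). The quantity $S_T$ is an upper bound for the averaged loss $\frac1T\sum_{t=1}^T[f(x_t)-f(x^* )]$. *)

(* Defs.v *)
From HB Require Import structures.
From mathcomp Require Import all_boot all_order all_algebra.
From mathcomp Require Import all_classical all_reals all_analysis.
Set Implicit Arguments. Unset Strict Implicit. Unset Printing Implicit Defensive.
Import Order.TTheory GRing.Theory Num.Theory.
Import numFieldNormedType.Exports.
Local Open Scope classical_set_scope.
Local Open Scope ring_scope.

Section Defs.
Context {R : realType} {d : nat}.

Definition dotv (u v : 'rV[R]_d) : R := (u *m v^T) 0 0.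
Definition sqnorm (u : 'rV[R]_d) : R := dotv u u.
Definition enorm (u : 'rV[R]_d) : R := Num.sqrt (sqnorm u).

Definition convex_fun (f : 'rV[R]_d -> R) :=
  forall (x y : 'rV[R]_d) (l : R), 0 <= l <= 1 ->
    f (l *: x + (1 - l) *: y) <= l * f x + (1 - l) * f y.

Context {dT : measure_display} {Omega : measurableType dT}.

Definition rvec_measurable (X : Omega -> 'rV[R]_d) :=
  forall i : 'I_d, measurable_fun setT (fun w => X w 0 i).

Definition rect_event (X : Omega -> 'rV[R]_d) (A : 'I_d -> set R) : set Omega :=
  [set w | forall i : 'I_d, A i (X w 0 i)].

(* mutual independence of X_0, ..., X_{n-1}: product rule on the
   measurable rectangles (a pi-system generating the Borel sets of R^d);
   subfamilies are obtained by taking A t i = setT. *)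
Definition mutually_independent (P : probability Omega R)
  (X : nat -> Omega -> 'rV[R]_d) (n : nat) :=
  forall A : nat -> 'I_d -> set R, (forall t i, measurable (A t i)) ->
    P (\bigcap_(t in [set k | (k < n)%N]) rect_event (X t) (A t)) =
    (\prod_(t < n) P (rect_event (X t) (A t)))%E.

(* X and -X have the same distribution (equality on measurable rectangles,
   a pi-system generating the Borel sets of R^d) *)
Definition symmetric_distribution (P : probability Omega R)
  (X : Omega -> 'rV[R]_d) :=
  forall A : 'I_d -> set R, (forall i, measurable (A i)) ->
    P (rect_event X A) = P (rect_event (fun w => - X w) A).

End Defs.

(* Main.v *)
Require Import Defs.
From HB Require Import structures.
From mathcomp Require Import all_boot all_order all_algebra.
From mathcomp Require Import all_classical all_reals all_analysis.
From mathcomp Require Import measurable_realfun ring lra.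
Import Order.TTheory GRing.Theory Num.Theory.
Import numFieldNormedType.Exports.
Local Open Scope classical_set_scope.
Local Open Scope ring_scope.

(* Up to a constant, [S_T] is [1/T] times a sum of the increments
   [D_t = c_t (|eps_t|^2 - E|eps_t|^2) - eps_t . y_t], where
   [c_t = gamma_t (1 + L gamma_t) / 2 <= 1/L] and
   [y_t = x_t - L gamma_t^2 g_t - xstar] depends only on
   [eps_0, ..., eps_(t-1)], with [|y_t|^2 <= 4 M^2]. The [D_t] are martingale
   differences, so the variance of the sum is the sum of the [E D_t^2]. The two
   parts of [D_t] are uncorrelated because [|eps_t|^2 eps_t] has mean zero by
   symmetry, whence [E D_t^2 <= c_t^2 E|eps_t|^4 + 4 M^2 E|eps_t|^2]. *)

Set Implicit Arguments.
Unset Strict Implicit.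
Unset Printing Implicit Defensive.

(** * Euclidean geometry *)

Section Euclidean.
Context {R : realType} {d : nat}.
Implicit Types (u v : 'rV[R]_d) (a : R).

Lemma dotvE u v : dotv u v = \sum_i u 0 i * v 0 i.
Proof. by rewrite /dotv mxE; apply: eq_bigr => i _; rewrite mxE. Qed.

Lemma dotvC u v : dotv u v = dotv v u.
Proof. by rewrite !dotvE; apply: eq_bigr => i _; rewrite mulrC. Qed.

Lemma dotvDl u u' v : dotv (u + u') v = dotv u v + dotv u' v.
Proof. by rewrite /dotv mulmxDl mxE. Qed.

Lemma dotvZl a u v : dotv (a *: u) v = a * dotv u v.
Proof. by rewrite /dotv -scalemxAl mxE. Qed.

Lemma dotvDr u v v' : dotv u (v + v') = dotv u v + dotv u v'.
Proof. by rewrite !(dotvC u) dotvDl. Qed.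

Lemma dotvZr a u v : dotv u (a *: v) = a * dotv u v.
Proof. by rewrite !(dotvC u) dotvZl. Qed.

Lemma dotvNr u v : dotv u (- v) = - dotv u v.
Proof. by rewrite -scaleN1r dotvZr mulN1r. Qed.

Lemma dotvNl u v : dotv (- u) v = - dotv u v.
Proof. by rewrite dotvC dotvNr dotvC. Qed.

Lemma sqnormE u : sqnorm u = \sum_i u 0 i ^+ 2.
Proof. by rewrite /sqnorm dotvE; apply: eq_bigr => i _; rewrite expr2. Qed.

Lemma sqnorm_ge0 u : 0 <= sqnorm u.
Proof. by rewrite sqnormE sumr_ge0// => i _; rewrite sqr_ge0. Qed.

Lemma sqnorm_eq0 u : (sqnorm u == 0) = (u == 0).
Proof.
apply/eqP/eqP => [|->]; last first.
  by rewrite sqnormE big1// => i _; rewrite mxE expr0n.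
rewrite sqnormE => /psumr_eq0P u0; apply/rowP => i; rewrite mxE; apply/eqP.
by rewrite -sqrf_eq0 u0// => j _; rewrite sqr_ge0.
Qed.

Lemma sqnormN u : sqnorm (- u) = sqnorm u.
Proof. by rewrite !sqnormE; apply: eq_bigr => i _; rewrite mxE sqrrN. Qed.

Lemma sqnormZ a u : sqnorm (a *: u) = a ^+ 2 * sqnorm u.
Proof. by rewrite /sqnorm dotvZl dotvZr mulrA. Qed.

Lemma le_sqr_coord_sqnorm u i : u 0 i ^+ 2 <= sqnorm u.
Proof.
by rewrite sqnormE (bigD1 i)//= lerDl sumr_ge0// => j _; rewrite sqr_ge0.
Qed.

(** Cauchy-Schwarz: the squared norm of [sqnorm v *: u - dotv u v *: v] is nonnegative and factors
    as [sqnorm v] times the difference of the two sides. *)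
Lemma sqr_dotv_le u v : dotv u v ^+ 2 <= sqnorm u * sqnorm v.
Proof.
have [->|v0] := eqVneq v 0.
  rewrite -(scale0r 0) dotvZr mul0r expr0n /= mulr_ge0 ?sqnorm_ge0//.
have v_gt0 : 0 < sqnorm v by rewrite lt_def sqnorm_ge0 sqnorm_eq0 v0.
have := sqnorm_ge0 (sqnorm v *: u - dotv u v *: v).
have -> : sqnorm (sqnorm v *: u - dotv u v *: v) =
    sqnorm v * (sqnorm u * sqnorm v - dotv u v ^+ 2).
  rewrite {1}/sqnorm -scaleNr dotvDl !dotvDr !dotvZl !dotvZr (dotvC v u).
  by rewrite -/(sqnorm u) -/(sqnorm v); ring.
by rewrite pmulr_rge0// subr_ge0.
Qed.

(** By the parallelogram identity the gap between the two sides is exactly [sqnorm (u + v)]. *)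
Lemma sqnormB_le u v : sqnorm (u - v) <= 2 * sqnorm u + 2 * sqnorm v.
Proof.
have := sqnorm_ge0 (u + v).
rewrite /sqnorm !dotvDl !dotvDr !dotvNl !dotvNr (dotvC v u) => h.
by rewrite -subr_ge0 (le_trans h)// le_eqVlt; apply/orP; left; apply/eqP; ring.
Qed.

Lemma enorm_ge0 u : 0 <= enorm u. Proof. exact: sqrtr_ge0. Qed.

Lemma sqr_enorm u : enorm u ^+ 2 = sqnorm u.
Proof. by rewrite sqr_sqrtr// sqnorm_ge0. Qed.

Lemma le_coord_enorm u i : `|u 0 i| <= enorm u.
Proof.
rewrite -(ler_pXn2r (n := 2)) ?nnegrE ?enorm_ge0//.
by rewrite sqr_enorm -normrX ger0_norm ?sqr_ge0// le_sqr_coord_sqnorm.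
Qed.

Lemma enorm_le_sum u : enorm u <= \sum_i `|u 0 i|.
Proof.
have S0 : 0 <= \sum_i `|u 0 i| by exact: sumr_ge0.
rewrite -(ler_pXn2r (n := 2)) ?nnegrE ?enorm_ge0// sqr_enorm sqnormE.
rewrite expr2 mulr_suml ler_sum// => i _.
rewrite -real_normK ?num_real// expr2 ler_wpM2l//.
by rewrite (bigD1 i)//= lerDl sumr_ge0.
Qed.

End Euclidean.

(** Taken as a limit from the right, each directional derivative at a minimizer is a limit of
    nonnegative quotients. In the direction [- g a] it equals [- sqnorm (g a)], which forces the
    gradient to vanish. *)
Lemma gradient_at_min (R : realType) (d : nat) (f : 'rV[R]_d -> R)
  (g : 'rV[R]_d -> 'rV[R]_d) (a : 'rV[R]_d) :
  differentiable f a -> (forall v, 'D_v f a = dotv (g a) v) ->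
  (forall y, f a <= f y) -> g a = 0.
Proof.
move=> df Dg fmin.
have D_ge0 v : 0 <= 'D_v f a.
  have dv : derivable f a v by exact: diff_derivable.
  rewrite /derive cvg_at_rightE; last exact: dv.
  apply: limr_ge.
    rewrite -(cvg_at_rightE (fun h : R => h^-1 *: ((f \o shift a) _ - f a))) //.
    apply: cvg_trans dv; apply: cvg_app.
    move=> A [e egt0 Ae]; exists e => // x xe xgt0; apply: Ae => //.
    exact/lt0r_neq0.
  near=> h; apply: mulr_ge0.
    by rewrite invr_ge0; apply: ltW; near: h; exact: nbhs_right_gt.
  by rewrite subr_ge0 fmin.
apply/eqP; rewrite -sqnorm_eq0 eq_le sqnorm_ge0 andbT.
by have := D_ge0 (- g a); rewrite Dg dotvNr oppr_ge0.
Unshelve. all: by end_near. Qed.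

(** * Independence and symmetry *)

(** Dynkin's argument: for fixed [B] both sides are finite measures in [C], and they agree on a
    pi-system that contains the whole space. *)
Lemma indep_generated (R : realType) (d : measure_display)
  (Omega : measurableType d) (P : probability Omega R)
  (T' : pointedType) (G : set (set T'))
  (X : Omega -> g_sigma_algebraType G) (B : set Omega) :
  measurable_fun setT X -> setI_closed G -> G setT -> measurable B ->
  (forall C, G C -> P (X @^-1` C `&` B) = (P (X @^-1` C) * P B)%E) ->
  forall C : set (g_sigma_algebraType G), measurable C ->
    P (X @^-1` C `&` B) = (P (X @^-1` C) * P B)%E.
Proof.
move=> mX GI GT mB PG.
pose X' : {mfun Omega >-> g_sigma_algebraType G} := mfun_Sub (mem_set mX).
have PB0 : 0 <= fine (P B) by rewrite fine_ge0.
have [m1 m1E] : exists m : {measure set (g_sigma_algebraType G) -> \bar R},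
    forall A, m A = P (X @^-1` A `&` B).
  by unshelve eexists (pushforward (mrestr P mB) X').
pose m2 : {measure set (g_sigma_algebraType G) -> \bar R} :=
  mscale (NngNum PB0) (distribution P X').
have m2E A : m2 A = (P (X @^-1` A) * P B)%E.
  by rewrite /m2 /= /mscale /= fineK ?fin_num_measure// muleC.
move=> C mC; rewrite -m1E -m2E.
apply: (@g_sigma_algebra_measure_unique _ R (g_sigma_algebraType G) G _
  (fun=> setT)) => //.
- by move=> A GA; exact: sub_sigma_algebra.
- by rewrite bigcup_const.
- by move=> A GA; rewrite m1E m2E -PG.
- move=> _; rewrite m1E (le_lt_trans (probability_le1 _ _)) ?ltry//.
  by rewrite preimage_setT setTI.
Qed.

(** The law of the pair agrees with the product of the two laws on rectangles, hence everywhere, and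
    Fubini then factors the integral. *)
Lemma indep_expectationM (R : realType) (d d1 d2 : measure_display)
  (Omega : measurableType d) (P : probability Omega R)
  (T1 : measurableType d1) (T2 : measurableType d2)
  (X : Omega -> T1) (Y : Omega -> T2) (u : T1 -> R) (v : T2 -> R) :
  measurable_fun setT X -> measurable_fun setT Y ->
  measurable_fun setT u -> measurable_fun setT v ->
  (forall A B, measurable A -> measurable B ->
    P (X @^-1` A `&` Y @^-1` B) = (P (X @^-1` A) * P (Y @^-1` B))%E) ->
  P.-integrable setT (EFin \o (u \o X)) ->
  P.-integrable setT (EFin \o (v \o Y)) ->
  P.-integrable setT (EFin \o (fun w => u (X w) * v (Y w))) /\
  \int[P]_w (u (X w) * v (Y w)) = \int[P]_w u (X w) * \int[P]_w v (Y w).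
Proof.
move=> mX mY mu mv PXY iu iv.
pose X' : {mfun Omega >-> T1} := mfun_Sub (mem_set mX).
pose Y' : {mfun Omega >-> T2} := mfun_Sub (mem_set mY).
have mXY : measurable_fun setT (fun w => (X w, Y w)).
  exact/measurable_fun_pair.
pose XY : {mfun Omega >-> (T1 * T2)%type} := mfun_Sub (mem_set mXY).
pose PX : probability T1 R := distribution P X'.
pose PY : probability T2 R := distribution P Y'.
pose PP : probability (T1 * T2)%type R := distribution P XY.
have PPE : forall A, measurable A -> (PX \x PY)%E A = PP A.
  apply: product_measure_unique => A B mA mB.
  by rewrite -PXY.
pose h : (T1 * T2)%type -> \bar R := fun z => (u z.1 * v z.2)%:E.
have mh : measurable_fun setT h.
  apply/measurable_EFinP; apply: measurable_funM; exact: measurableT_comp.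
have iuX : PX.-integrable setT (EFin \o u).
  by apply: integrable_pushforward => //; exact/measurable_EFinP.
have ivY : PY.-integrable setT (EFin \o v).
  by apply: integrable_pushforward => //; exact/measurable_EFinP.
(* Tonelli: integrating the absolute value first in the second variable leaves [|u|] times the
   finite constant [E|v|]. *)
have ih : (PX \x PY)%E.-integrable setT h.
  apply/integrable12ltyP => //.
  under eq_integral.
    move=> a _.
    under eq_integral do rewrite /h /= normrM EFinM.
    rewrite ge0_integralZl//=; last first.
      by apply/measurable_EFinP; exact: measurableT_comp.
    over.
  have iv' : (\int[PY]_y `|v y|%:E)%E \is a fin_num.
    by apply: integrable_fin_num => //; exact: integrable_norm.
  rewrite -(fineK iv') ge0_integralZr//=.
  - apply: lte_mul_pinfty => //; first exact: integral_ge0.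
    + by apply: integrable_fin_num => //; exact: integrable_norm.
    + by rewrite ltry.
  - by apply/measurable_EFinP; exact: measurableT_comp.
  - by rewrite lee_fin fine_ge0// integral_ge0.
have ihP : PP.-integrable setT h.
  apply/integrableP; split => //; case/integrableP : ih => _.
  by rewrite (eq_measure_integral PP)// => A mA _; exact: PPE.
have iM : P.-integrable setT (EFin \o (fun w => u (X w) * v (Y w))).
  apply/integrableP; split.
    exact: (measurableT_comp mh mXY).
  case/integrableP : ihP => _.
  by rewrite ge0_integral_distribution//; exact: measurableT_comp.
split => //.
have -> : \int[P]_w (u (X w) * v (Y w)) = fine (\int[PP]_z h z)%E.
  by rewrite /Rintegral integral_distribution.
have -> : fine (\int[PP]_z h z)%E = fine (\int[(PX \x PY)%E]_z h z)%E.
  rewrite /Rintegral; congr fine.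
  by apply: eq_measure_integral => A mA _; exact/esym/PPE.
rewrite /Rintegral -integral12_prod_meas1//=.
have -> : (\int[P]_w (u (X w))%:E = \int[PX]_w (u w)%:E)%E.
  by rewrite integral_distribution//; exact/measurable_EFinP.
have -> : (\int[P]_w (v (Y w))%:E = \int[PY]_w (v w)%:E)%E.
  by rewrite integral_distribution//; exact/measurable_EFinP.
have fv : (\int[PY]_y (v y)%:E)%E \is a fin_num by exact: integrable_fin_num.
rewrite -fineM//; last exact: integrable_fin_num.
congr fine; rewrite -{1}(fineK fv) -integralZr//.
apply: eq_integral => a _; rewrite /fubini_F /h /=.
under eq_integral do rewrite EFinM.
by rewrite integralZl// fineK.
Qed.

(** These are the sets on which independence and symmetry are assumed, so both hypotheses can be fed
    directly to a pi-system argument. *)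
Definition rectangles (R : realType) (d : nat) : set (set 'rV[R]_d) :=
  [set B | exists2 A : 'I_d -> set R, (forall i, measurable (A i)) &
    B = [set u : 'rV[R]_d | forall i, A i (u 0 i)]].

Arguments rectangles : clear implicits.

Notation borel R d := (g_sigma_algebraType (rectangles R d)).

(** * Borel structure on row vectors, and symmetric laws *)

Section Rectangles.
Context {R : realType} {d : nat}.

Lemma rectangles_setI : setI_closed (rectangles R d).
Proof.
move=> _ _ [A mA ->] [B mB ->]; exists (fun i => A i `&` B i).
  by move=> i; exact: measurableI.
by apply/seteqP; split => u /= => [[Au Bu] i|ABu]; split => // i; case: (ABu i).
Qed.

Lemma rectangles_setT : rectangles R d setT.
Proof. by exists (fun=> setT) => //; apply/seteqP; split. Qed.

Lemma measurable_coord (i : 'I_d) :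
  measurable_fun setT (fun u : borel R d => u 0 i).
Proof.
move=> _ B mB; rewrite setTI; apply: sub_sigma_algebra.
exists (fun j => if j == i then B else setT) => [j|]; first by case: ifP.
apply/seteqP; split => [u /= Bu j|u /= /(_ i)]; last by rewrite eqxx.
by case: eqP => // ->.
Qed.

Lemma measurable_sqnorm : measurable_fun setT (fun u : borel R d => sqnorm u).
Proof.
rewrite (_ : (fun u => _) = fun u : borel R d => \sum_i u 0 i ^+ 2); last first.
  by apply/funext => u; rewrite sqnormE.
apply: measurable_sum => i; apply: measurable_funX.
exact: measurable_coord.
Qed.

Context {dT : measure_display} {Omega : measurableType dT}.

Lemma measurable_rect_event (X : Omega -> 'rV[R]_d) (A : 'I_d -> set R) :
  rvec_measurable X -> (forall i, measurable (A i)) ->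
  measurable (rect_event X A).
Proof.
move=> mX mA.
rewrite (_ : rect_event X A = \bigcap_(i in [set: 'I_d])
    ((fun w => X w 0 i) @^-1` A i)).
  apply: fin_bigcap_measurable => // i _.
  by rewrite -[X in measurable X]setTI; exact: mX.
by apply/seteqP; split => [w Aw i _|w Aw i]; exact: Aw.
Qed.

Lemma rvec_measurable_borel (X : Omega -> 'rV[R]_d) :
  rvec_measurable X -> measurable_fun setT (X : Omega -> borel R d).
Proof.
move=> mX.
apply: (@measurability _ _ _ (borel R d) setT X (rectangles R d)) => //.
move=> _ [_ [A mA ->] <-].
by rewrite setTI; exact: measurable_rect_event.
Qed.

(** The laws of [X] and [- X] agree on rectangles, hence on all Borel sets, so
    [E v(X) = E v(- X) = - E v(X)]. *)
Lemma odd_expectation0 (P : probability Omega R) (X : Omega -> 'rV[R]_d)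
    (v : 'rV[R]_d -> R) :
  rvec_measurable X -> symmetric_distribution P X ->
  measurable_fun setT (v : borel R d -> R) -> (forall u, v (- u) = - v u) ->
  P.-integrable setT (EFin \o (v \o X)) -> \int[P]_w v (X w) = 0.
Proof.
move=> mX sX mv vN iv.
have mX' := rvec_measurable_borel mX.
have mXN : measurable_fun setT ((fun w => - X w) : Omega -> borel R d).
  apply: rvec_measurable_borel => i.
  rewrite (_ : (fun w => _) = fun w => - X w 0 i); last first.
    by apply/funext => w; rewrite mxE.
  exact: measurableT_comp.
pose Y : {mfun Omega >-> borel R d} := mfun_Sub (mem_set mX').
pose Z : {mfun Omega >-> borel R d} := mfun_Sub (mem_set mXN).
have YZ : forall B, measurable B -> distribution P Y B = distribution P Z B.
  move=> B mB; apply: (@g_sigma_algebra_measure_unique _ R (borel R d)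
    (rectangles R d) _ (fun=> setT)) => //.
  - by move=> A GA; exact: sub_sigma_algebra.
  - by move=> _; exact: rectangles_setT.
  - by rewrite bigcup_const.
  - exact: rectangles_setI.
  - by move=> _ [A mA ->]; exact: sX.
  - by move=> _; rewrite (le_lt_trans (probability_le1 _ _)) ?ltry.
have mv' : measurable_fun setT (EFin \o (v : borel R d -> R)).
  exact/measurable_EFinP.
have ivN : P.-integrable setT (EFin \o (fun w => v (- X w))).
  rewrite (_ : EFin \o _ = -%E \o (EFin \o (v \o X))); first exact: integrableN.
  by apply/funext => w; rewrite /= vN.
have : \int[P]_w v (X w) = \int[P]_w v (- X w).
  rewrite /Rintegral.
  rewrite -(integral_distribution (X := Y) mv' iv).
  rewrite -(integral_distribution (X := Z) mv' ivN).
  by congr fine; apply: eq_measure_integral => B mB _; exact: YZ.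
rewrite [RHS](_ : _ = - \int[P]_w v (X w)); last first.
  rewrite -mulN1r -RintegralZl//; apply: eq_Rintegral => w _.
  by rewrite vN mulN1r.
by lra.
Qed.

End Rectangles.

(** * The filtration generated by the errors *)

Section History.
Context {R : realType} {d : nat} {dT : measure_display}
  {Omega : measurableType dT}.
Variable eps : nat -> Omega -> 'rV[R]_d.

(* A pi-system generating the sigma-algebra of [eps 0, ..., eps n.-1]. *)
Definition history (n : nat) : set (set Omega) :=
  [set B | exists2 A : nat -> 'I_d -> set R, (forall t i, measurable (A t i)) &
    B = \bigcap_(t in [set k | (k < n)%N]) rect_event (eps t) (A t)].

Notation past n := (g_sigma_algebraType (history n)).

Lemma history_setI n : setI_closed (history n).
Proof.
move=> _ _ [A mA ->] [B mB ->]; exists (fun t i => A t i `&` B t i).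
  by move=> t i; exact: measurableI.
apply/seteqP; split => w /= => [[Aw Bw] t tn i|ABw].
  by split; [exact: Aw|exact: Bw].
by split => t tn i; case: (ABw t tn i).
Qed.

Lemma history_setT n : history n setT.
Proof. by exists (fun _ _ => setT) => //; apply/seteqP; split. Qed.

Lemma history_coord_measurable n t i : (t < n)%N ->
  measurable_fun setT (fun w : past n => eps t w 0 i).
Proof.
move=> tn _ B mB; rewrite setTI; apply: sub_sigma_algebra.
exists (fun s j => if (s == t) && (j == i) then B else setT).
  by move=> s j; case: ifP.
apply/seteqP; split => [w /= Bw s _ j|w /= /(_ t tn i)]; last by rewrite !eqxx.
by case: ifP => // /andP[/eqP -> /eqP ->].
Qed.

Lemma history_sub n : history n `<=` history n.+1.
Proof.
(* Padding with [setT] at time [n] leaves the new error unconstrained. *)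
move=> _ [A mA ->]; exists (fun t i => if (t < n)%N then A t i else setT).
  by move=> t i; case: ifP.
apply/seteqP; split => w /= Aw t /= tn i.
  by case: ifP => // tn'; exact: Aw.
by have := Aw t (ltnW tn) i; rewrite /= tn.
Qed.

Lemma past_measurable_funS n (u : Omega -> R) :
  measurable_fun setT (u : past n -> R) ->
  measurable_fun setT (u : past n.+1 -> R).
Proof.
move=> mu mD B mB; have := mu measurableT B mB.
apply: sub_sigma_algebra2; exact: history_sub.
Qed.

Hypothesis meps : forall t, rvec_measurable (eps t).

Lemma history_measurable n : history n `<=` measurable.
Proof.
move=> _ [A mA ->]; apply: bigcap_measurableType => // t _.
exact: measurable_rect_event.
Qed.

(** [past n] is [Omega] with a coarser sigma-algebra. The identity into it serves as the random
    variable that records the first [n] errors. *)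
Lemma measurable_past n : measurable_fun setT (id : Omega -> past n).
Proof.
apply: (@measurability _ _ Omega (past n) setT (fun w => w) (history n)) => //.
move=> _ [B hB <-].
by rewrite setTI; exact: history_measurable hB.
Qed.

(** This expresses that [v (eps n)] has conditional mean zero given the past, by testing it against
    integrable past-measurable [u]. The identity into [past n] is independent of [eps n], so the
    expectation factors. *)
Lemma past_indep_expectation0 (P : probability Omega R) n (u : Omega -> R)
    (v : 'rV[R]_d -> R) :
  (forall m, mutually_independent P eps m) ->
  measurable_fun setT (u : past n -> R) ->
  measurable_fun setT (v : borel R d -> R) ->
  P.-integrable setT (EFin \o u) ->
  P.-integrable setT (EFin \o (v \o eps n)) ->
  \int[P]_w v (eps n w) = 0 ->
  P.-integrable setT (EFin \o (fun w => u w * v (eps n w))) /\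
  \int[P]_w (u w * v (eps n w)) = 0.
Proof.
move=> ind mu mv iu iv v0.
have me := rvec_measurable_borel (meps n).
have [|ie E] := indep_expectationM (@measurable_past n) me mu mv _ iu iv;
  last by rewrite E v0 mulr0.
move=> A B mA mB.
have mB' : measurable (eps n @^-1` B).
  by rewrite -[X in measurable X]setTI; exact: me.
(* Two extensions from generators: first the past event is reduced to one in [history n], then the
   event on [eps n] to a rectangle. *)
apply: (@indep_generated _ _ _ P Omega (history n) id _ (@measurable_past n)
  (@history_setI n) (@history_setT n) mB' _ A mA) => C hC.
rewrite setIC muleC; have mC := history_measurable hC.
apply: (@indep_generated _ _ _ P 'rV[R]_d (rectangles R d) (eps n) _ me
  rectangles_setI rectangles_setT mC _ B mB).
move=> _ [D mD ->]; case: hC => A' mA' ->; rewrite muleC setIC.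
(* One family holding both events: the product rule for [n.+1] errors splits off the factor of [D],
   and the rule for [n] errors reassembles the rest. *)
pose A'' t := if (t < n)%N then A' t else D.
have mA'' t i : measurable (A'' t i) by rewrite /A''; case: ifP.
have Pn : P (\bigcap_(t in [set k | (k < n)%N]) rect_event (eps t) (A' t)) =
    (\prod_(t < n) P (rect_event (eps t) (A'' t)))%E.
  rewrite ind//; apply: eq_bigr => t _; by rewrite /A'' ltn_ord.
have := ind n.+1 A'' mA''; rewrite big_ord_recr /= -Pn /A'' ltnn => <-.
congr (P _); apply/seteqP; split => [w [A'w Dw] t /=|w Aw].
  by rewrite ltnS leq_eqVlt => /orP[/eqP ->|tn];
    [rewrite ltnn|rewrite tn; exact: A'w].
split => [t /= tn|]; first by have := Aw t (ltnW tn); rewrite tn.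
by have := Aw n (ltnSn n); rewrite ltnn.
Qed.

End History.

(** * Measurability of Lipschitz functions *)

Lemma rational_row_dense (R : realType) (d : nat) (u : 'rV[R]_d) (e : R) :
  0 < e -> exists q : 'rV[rat]_d, \sum_i `|(u - map_mx ratr q) 0 i| < e.
Proof.
(* With [d.+1] in place of [d], a sum of [d] errors of size at most [c] stays strictly below [e],
   and dimension zero is covered. *)
move=> e0; pose c := e / d.+1%:R.
have c0 : 0 < c by rewrite divr_gt0.
have /choice[q qP] : forall i, exists q : rat, `|u 0 i - ratr q| <= c.
  move=> i; have /rat_in_itvoo[q] : u 0 i - c < u 0 i + c by lra.
  by rewrite in_itv /= => /andP[q1 q2]; exists q; rewrite ler_norml; lra.
exists (\row_i q i); apply: (@le_lt_trans _ _ (\sum_(i < d) c)).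
  by apply: ler_sum => i _; rewrite !mxE.
rewrite sumr_const card_ord -mulr_natr /c -mulrA gtr_pMr//.
by rewrite mulrC ltr_pdivrMr// mul1r ltr_nat.
Qed.

(* McShane: [h u] is the infimum of [h q + L * |u - q|] over a countable dense
   set of points [q]. *)
Lemma lipschitz_measurable (R : realType) (d : nat) (d0 : measure_display)
  (T : measurableType d0) (h : 'rV[R]_d -> R) (L : R) (X : T -> 'rV[R]_d) :
  0 <= L -> (forall u v, `|h u - h v| <= L * enorm (u - v)) ->
  rvec_measurable X -> measurable_fun setT (fun w => h (X w)).
Proof.
move=> L0 hL mX.
have h1 u v : `|h u - h v| <= L * \sum_i `|(u - v) 0 i|.
  by apply: le_trans (hL _ _) _; rewrite ler_wpM2l// enorm_le_sum.
(* An enumeration of the rational points; integers that encode no point are sent to the origin. *)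
pose q n : 'rV[R]_d := map_mx ratr (odflt 0 (unpickle n : option 'rV[rat]_d)).
move=> mD; apply: (measurability _ (RGenInftyO.measurableE R)) => //.
move=> /= _ [_ [c ->] <-]; rewrite setTI.
(* An infimum lies below [c] exactly when one of its members does, so the preimage is a countable
   union. *)
rewrite [X in measurable X](_ : _ = \bigcup_n
  ((fun w => h (q n) + L * \sum_i `|(X w - q n) 0 i|) @^-1` `]-oo, c[%classic)).
  apply: bigcupT_measurable => n; rewrite -[X in measurable X]setTI.
  suff : measurable_fun setT (fun w => h (q n) + L * \sum_i `|(X w - q n) 0 i|).
    by apply => //; exact: measurable_itv.
  apply: measurable_funD => //; apply: measurable_funM => //.
  apply: measurable_sum => i; apply: measurableT_comp => //.
  rewrite (_ : (fun w => _) = (fun w => X w 0 i - q n 0 i)); last first.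
    by apply/funext => w; rewrite !mxE.
  by apply: measurable_funB => //; exact: mX.
apply/seteqP; split => [w /=|w [n _] /=]; rewrite !in_itv /= => hc; last first.
  apply: le_lt_trans hc; have := h1 (X w) (q n).
  by rewrite ler_norml => /andP[_]; lra.
(* If [p] is at l1 distance [s] from [X w], then [h p + L * s <= h (X w) + 2 * L * s]. The extra 1
   keeps the denominator positive when [L = 0]. *)
have e0 : 0 < (c - h (X w)) / (2 * L + 1) by rewrite divr_gt0//; lra.
have [p pP] := rational_row_dense (X w) e0.
exists (pickle p) => //=; rewrite in_itv /= /q pickleK /=.
set s := \sum_i _ in pP *.
have s0 : 0 <= s by exact: sumr_ge0.
have := h1 (X w) (map_mx ratr p); rewrite -/s ler_norml => /andP[hs _].
move: pP; rewrite ltr_pdivlMr; last by lra.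
by rewrite mulrDr mulr1; nra.
Qed.

(** * Martingale increments *)

Section Integrable.
Context {R : realType} {dT : measure_display} {Omega : measurableType dT}.
Variable P : probability Omega R.
Implicit Types f g : Omega -> R.

Definition rintegrable f := P.-integrable setT (fun w => (f w)%:E).

Lemma rintegrable_dominated f g : measurable_fun setT f -> rintegrable g ->
  (forall w, `|f w| <= g w) -> rintegrable f.
Proof.
move=> mf ig fg; apply: (le_integrable measurableT _ _ ig).
  exact/measurable_EFinP.
by move=> w _ /=; rewrite lee_fin (le_trans (fg w))// ler_norm.
Qed.

Lemma rintegrable_cst k : rintegrable (fun=> k).
Proof. exact: finite_measure_integrable_cst. Qed.

Lemma Rintegral_probability_cst (k : R) : \int[P]_w k = k.
Proof.
transitivity (k * fine (P setT)); first exact: Rintegral_cst.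
by rewrite probability_setT mulr1.
Qed.

Lemma rintegrableD f g : rintegrable f -> rintegrable g ->
  rintegrable (fun w => f w + g w).
Proof. by move=> fi gi; exact: (integrableD measurableT fi gi). Qed.

Lemma rintegrableZ k f : rintegrable f -> rintegrable (fun w => k * f w).
Proof. by move=> fi; exact: (integrableZl measurableT k fi). Qed.

Lemma rintegrable_of_sqr f : measurable_fun setT f ->
  rintegrable (fun w => f w ^+ 2) -> rintegrable f.
Proof.
move=> mf if2; apply: (@rintegrable_dominated _ (fun w => 1 + f w ^+ 2)) => //.
  by apply: rintegrableD => //; exact: rintegrable_cst.
by move=> w; rewrite ler_norml; nra.
Qed.

Lemma rintegrableM f g : measurable_fun setT f -> measurable_fun setT g ->
  rintegrable (fun w => f w ^+ 2) -> rintegrable (fun w => g w ^+ 2) ->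
  rintegrable (fun w => f w * g w).
Proof.
move=> mf mg if2 ig2.
apply: (@rintegrable_dominated _ (fun w => f w ^+ 2 + g w ^+ 2)).
- exact: measurable_funM.
- exact: rintegrableD.
- by move=> w; rewrite ler_norml; nra.
Qed.

(** Integrability is included because the real-valued integral takes the default value 0 when the
    extended one is infinite. *)
Definition centered f := rintegrable f /\ \int[P]_w f w = 0.

Lemma centeredD f g : centered f -> centered g -> centered (fun w => f w + g w).
Proof.
move=> [fi f0] [gi g0]; split; first exact: rintegrableD.
by rewrite RintegralD// f0 g0 addr0.
Qed.

Lemma centeredZ k f : centered f -> centered (fun w => k * f w).
Proof.
move=> [fi f0]; split; first exact: rintegrableZ.
by rewrite RintegralZl// f0 mulr0.
Qed.

Lemma centered_sum I (s : seq I) (f : I -> Omega -> R) :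
  (forall i, centered (f i)) -> centered (fun w => \sum_(i <- s) f i w).
Proof.
move=> fc; elim: s => [|i s IHs].
  rewrite (_ : (fun w => _) = fun=> 0); last first.
    by apply/funext => w; rewrite big_nil.
  by split; [exact: rintegrable_cst|rewrite Rintegral_probability_cst].
rewrite (_ : (fun w => _) = fun w => f i w + \sum_(i <- s) f i w).
  exact: centeredD.
by apply/funext => w; rewrite big_cons.
Qed.

End Integrable.

(** * A single martingale increment *)

Section Increment.
Context {R : realType} {d : nat} {dT : measure_display}
  {Omega : measurableType dT}.
Variables (P : probability Omega R) (eps : nat -> Omega -> 'rV[R]_d).
Hypotheses (meps : forall t, rvec_measurable (eps t))
  (ind : forall n, mutually_independent P eps n)
  (ieps : forall t (i : 'I_d), rintegrable P (fun w => eps t w 0 i))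
  (eps0 : forall t (i : 'I_d), \int[P]_w eps t w 0 i = 0)
  (sym : forall t, symmetric_distribution P (eps t))
  (iq2 : forall t, rintegrable P (fun w => sqnorm (eps t w) ^+ 2)).

Notation past n := (g_sigma_algebraType (history eps n)).

Variables (n : nat) (c K : R) (y : Omega -> 'rV[R]_d).
Hypotheses (my : forall i, measurable_fun setT (fun w : past n => y w 0 i))
  (yK : forall w, sqnorm (y w) <= K).

Let q w := sqnorm (eps n w).
Let m := \int[P]_w q w.
Let e := eps n.

Definition increment w := c * (q w - m) - dotv (e w) (y w).

Lemma past_measurable (u : Omega -> R) :
  measurable_fun setT (u : past n -> R) -> measurable_fun setT u.
Proof.
by move=> mu; exact: (measurableT_comp mu (measurable_past meps (n := n))).
Qed.

Let mq : measurable_fun setT q.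
Proof.
exact: (measurableT_comp (@measurable_sqnorm R d)
  (rvec_measurable_borel (meps n))).
Qed.

Let iq : rintegrable P q.
Proof. exact: (rintegrable_of_sqr mq (iq2 n)). Qed.

Let iqm2 : rintegrable P (fun w => (q w - m) ^+ 2).
Proof.
rewrite (_ : (fun w => _) = fun w => q w ^+ 2 + ((- 2 * m) * q w + m ^+ 2)).
  apply: rintegrableD; first exact: iq2.
  by apply: rintegrableD; [exact: rintegrableZ|exact: rintegrable_cst].
by apply/funext => w; ring.
Qed.

Let qm0 : centered P (fun w => q w - m).
Proof.
split.
  apply: rintegrableD => //; exact: rintegrable_cst.
rewrite RintegralB//; last exact: rintegrable_cst.
by rewrite Rintegral_probability_cst subrr.
Qed.

Let ie2 i : rintegrable P (fun w => e w 0 i ^+ 2).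
Proof.
apply: (rintegrable_dominated _ iq).
  by apply: measurable_funX; exact: meps.
by move=> w; rewrite ger0_norm ?sqr_ge0// le_sqr_coord_sqnorm.
Qed.

(** Symmetry of the errors enters here: the map [u |-> (sqnorm u - m) * u 0 i] is odd. Integrability
    comes from the square-integrability of both factors. *)
Let qme0 i : centered P (fun w => (q w - m) * e w 0 i).
Proof.
have mqm : measurable_fun setT (fun u : borel R d => (sqnorm u - m) * u 0 i).
  apply: measurable_funM; last exact: measurable_coord.
  by apply: measurable_funB => //; exact: measurable_sqnorm.
have iqme : rintegrable P (fun w => (q w - m) * e w 0 i).
  apply: rintegrableM => //; last exact: meps.
  by apply: measurable_funB.
split => //.
apply: (odd_expectation0 (v := fun u => (sqnorm u - m) * u 0 i) (meps n)
  (sym n) mqm _ iqme).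
by move=> u /=; rewrite sqnormN mxE mulrN.
Qed.

Let centered_past u v : measurable_fun setT (u : past n -> R) ->
  measurable_fun setT (v : borel R d -> R) ->
  rintegrable P u -> centered P (fun w => v (e w)) ->
  centered P (fun w => u w * v (e w)).
Proof.
move=> mu mv iu [iv v0].
exact: (past_indep_expectation0 meps ind mu mv iu iv v0).
Qed.

Let my' i : measurable_fun setT (fun w => y w 0 i).
Proof. exact: (past_measurable (my i)). Qed.

Let iy2 i : rintegrable P (fun w => y w 0 i ^+ 2).
Proof.
apply: (rintegrable_dominated _ (rintegrable_cst P K)).
  by apply: measurable_funX; exact: my'.
by move=> w; rewrite ger0_norm ?sqr_ge0// (le_trans (le_sqr_coord_sqnorm _ _)).
Qed.

(** The product is a combination of [N * (q - m)] and the [N * y_i * e_i], each a past-measurable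
    factor times a centered function of [eps n]. This removes the cross terms between different
    times. *)
Lemma increment_orthogonal (N : Omega -> R) :
  measurable_fun setT (N : past n -> R) -> rintegrable P (fun w => N w ^+ 2) ->
  centered P (fun w => N w * increment w).
Proof.
move=> mN iN2.
have mN' := past_measurable mN.
have iN := rintegrable_of_sqr mN' iN2.
rewrite (_ : (fun w => _) = fun w => c * (N w * (q w - m)) +
    (- 1) * \sum_i N w * y w 0 i * e w 0 i); last first.
  apply/funext => w; rewrite /increment dotvE mulrBr mulN1r mulr_sumr.
  by congr (_ - _); [ring|apply: eq_bigr => i _; ring].
apply: centeredD; apply: centeredZ.
  apply: (centered_past (v := fun u => sqnorm u - m)) => //.
  by apply: measurable_funB => //; exact: measurable_sqnorm.
apply: centered_sum => i.
apply: (centered_past (u := fun w => N w * y w 0 i) (v := fun u => u 0 i)).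
- by apply: measurable_funM.
- exact: measurable_coord.
- exact: rintegrableM.
- exact: (conj (ieps n i) (eps0 n i)).
Qed.

Lemma increment_sqr : rintegrable P (fun w => increment w ^+ 2) /\
  \int[P]_w increment w ^+ 2 <= c ^+ 2 * \int[P]_w q w ^+ 2 + K * m.
Proof.
pose z w := dotv (e w) (y w).
have mz : measurable_fun setT z.
  rewrite (_ : z = fun w => \sum_i e w 0 i * y w 0 i); last first.
    by apply/funext => w; rewrite /z dotvE.
  by apply: measurable_sum => i; apply: measurable_funM => //; exact: meps.
(* Cauchy-Schwarz together with the uniform bound on [y]. *)
have zK w : z w ^+ 2 <= K * q w.
  by rewrite (le_trans (sqr_dotv_le _ _))// mulrC ler_wpM2r// sqnorm_ge0.
have iz2 : rintegrable P (fun w => z w ^+ 2).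
  apply: (rintegrable_dominated _ (rintegrableZ K iq)).
    exact: measurable_funX.
  by move=> w; rewrite ger0_norm ?sqr_ge0.
(* The cross term within one increment: coordinatewise it is the past factor [y_i] times the odd
   function of [eps n] treated in [qme0]. *)
have [iqz qz0] : centered P (fun w => (q w - m) * z w).
  rewrite (_ : (fun w => _) = fun w => \sum_i y w 0 i * ((q w - m) * e w 0 i)).
    apply: centered_sum => i.
    apply: (centered_past (u := fun w => y w 0 i)
      (v := fun u => (sqnorm u - m) * u 0 i)) => //.
      apply: measurable_funM; last exact: measurable_coord.
      by apply: measurable_funB => //; exact: measurable_sqnorm.
    exact: rintegrable_of_sqr.
  by apply/funext => w; rewrite /z dotvE mulr_sumr; apply: eq_bigr => i _; ring.
have dE : (fun w => increment w ^+ 2) = (fun w => c ^+ 2 * (q w - m) ^+ 2 +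
    ((- 2 * c) * ((q w - m) * z w) + z w ^+ 2)).
  by apply/funext => w; rewrite /increment -/(z w); ring.
have i1 := rintegrableZ (c ^+ 2) iqm2.
have i2 := rintegrableZ (- 2 * c) iqz.
have i3 := rintegrableD i2 iz2.
split; first by rewrite dE; exact: rintegrableD.
rewrite dE RintegralD// RintegralZl// RintegralD// RintegralZl//.
rewrite qz0 mulr0 add0r.
apply: lerD; last first.
  rewrite -RintegralZl//; apply: le_Rintegral => //; exact: rintegrableZ.
apply: ler_wpM2l; first exact: sqr_ge0.
(* The square is expanded with linear term in [q w - m], whose mean is zero; discarding [- m ^+ 2]
   then leaves the fourth moment of the error. *)
have -> : \int[P]_w (q w - m) ^+ 2 = \int[P]_w q w ^+ 2 - m ^+ 2.
  rewrite (_ : (fun w => (q w - m) ^+ 2) =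
      fun w => q w ^+ 2 + ((- 2 * m) * (q w - m) + - m ^+ 2)); last first.
    by apply/funext => w; ring.
  case: qm0 => iqm Eqm.
  have j1 := rintegrableZ (- 2 * m) iqm.
  have j2 := rintegrable_cst P (- m ^+ 2).
  rewrite RintegralD//; [|exact: iq2|exact: rintegrableD].
  rewrite RintegralD// RintegralZl// Eqm mulr0 add0r.
  by rewrite Rintegral_probability_cst.
by rewrite gerBl sqr_ge0.
Qed.

(** The increment at time [n] involves [eps n] itself, hence the index [n.+1]; [y] is carried over
    from [past n]. *)
Lemma increment_past_measurable :
  measurable_fun setT (increment : g_sigma_algebraType (history eps n.+1) -> R).
Proof.
have me i : measurable_fun setT
    (fun w : g_sigma_algebraType (history eps n.+1) => e w 0 i).
  exact: history_coord_measurable.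
have -> : increment = fun w =>
    c * (\sum_i e w 0 i ^+ 2 - m) - \sum_i e w 0 i * y w 0 i.
  by apply/funext => w; rewrite /increment dotvE /q sqnormE.
apply: measurable_funB; last first.
  apply: measurable_sum => i; apply: measurable_funM => //.
  exact: past_measurable_funS.
apply: measurable_funM => //; apply: measurable_funB => //.
by apply: measurable_sum => i; exact: measurable_funX.
Qed.

End Increment.

(** * Second moment of the sum of increments *)

Section SumOfIncrements.
Context {R : realType} {d : nat} {dT : measure_display}
  {Omega : measurableType dT}.
Variables (P : probability Omega R) (eps : nat -> Omega -> 'rV[R]_d).
Hypotheses (meps : forall t, rvec_measurable (eps t))
  (ind : forall n, mutually_independent P eps n)
  (ieps : forall t (i : 'I_d), rintegrable P (fun w => eps t w 0 i))
  (eps0 : forall t (i : 'I_d), \int[P]_w eps t w 0 i = 0)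
  (sym : forall t, symmetric_distribution P (eps t))
  (iq2 : forall t, rintegrable P (fun w => sqnorm (eps t w) ^+ 2)).
Variables (c : nat -> R) (K : R) (y : nat -> Omega -> 'rV[R]_d).
Hypotheses (my : forall t i, measurable_fun setT
    (fun w : g_sigma_algebraType (history eps t) => y t w 0 i))
  (yK : forall t w, sqnorm (y t w) <= K).

Let D t := increment P eps t (c t) (y t).

Lemma centered_sum_increments s : centered P (fun w => \sum_(t <- s) D t w).
Proof.
apply: centered_sum => t.
(* Orthogonality to the constant 1 is the vanishing of the mean. *)
have := increment_orthogonal meps ind ieps eps0 iq2 (c t) (@my t) (yK t)
  (N := fun=> 1) (measurable_cst (1 : R)) (rintegrable_cst P (1 ^+ 2)).
by under eq_fun do rewrite mul1r.
Qed.

(** Pythagoras by induction. The three claims go together: measurability and square-integrability of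
    the partial sum up to time [n] make it orthogonal to the increment at [n.+1]. *)
Lemma sum_increments_sqr n :
  [/\ measurable_fun setT ((fun w => \sum_(1 <= t < n.+1) D t w) :
        g_sigma_algebraType (history eps n.+1) -> R),
    rintegrable P (fun w => (\sum_(1 <= t < n.+1) D t w) ^+ 2) &
    \int[P]_w (\sum_(1 <= t < n.+1) D t w) ^+ 2 <=
    \sum_(1 <= t < n.+1) (c t ^+ 2 * \int[P]_w sqnorm (eps t w) ^+ 2 +
                          K * \int[P]_w sqnorm (eps t w))].
Proof.
elim: n => [|n [mN iN2 N2]].
  have N0 w : \sum_(1 <= t < 1) D t w = 0 by rewrite big_geq.
  rewrite [X in _ <= X]big_geq//; split.
  - by under eq_fun do rewrite N0; exact: measurable_cst.
  - by under eq_fun do rewrite N0; exact: rintegrable_cst.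
  - under eq_Rintegral do rewrite N0.
    by rewrite Rintegral_probability_cst expr0n.
set N := fun w => \sum_(1 <= t < n.+1) D t w in mN iN2 N2.
have NS w : \sum_(1 <= t < n.+2) D t w = N w + D n.+1 w by rewrite big_nat_recr.
have [iND ND0] := increment_orthogonal meps ind ieps eps0 iq2 (c n.+1)
  (@my n.+1) (yK n.+1) mN iN2.
have [iD2 D2] := increment_sqr meps ind sym iq2 (c n.+1) (@my n.+1) (yK n.+1).
have mD := increment_past_measurable P (c n.+1) (@my n.+1).
have NE : (fun w => (\sum_(1 <= t < n.+2) D t w) ^+ 2) =
    (fun w => N w ^+ 2 + (2 * (N w * D n.+1 w) + D n.+1 w ^+ 2)).
  by apply/funext => w; rewrite NS; ring.
have i1 := rintegrableZ 2 iND; have i2 := rintegrableD i1 iD2.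
split.
- under eq_fun do rewrite NS; apply: measurable_funD => //.
  exact: past_measurable_funS.
- by rewrite NE; exact: rintegrableD.
- rewrite NE RintegralD// RintegralD// RintegralZl// ND0 mulr0 add0r.
  by rewrite big_nat_recr//= lerD.
Qed.

End SumOfIncrements.

(** * Variance of [S] *)

Lemma expectationE (R : realType) (dT : measure_display)
  (Omega : measurableType dT) (P : probability Omega R) (X : Omega -> R) :
  rintegrable P X -> ('E_P[X] = (\int[P]_w X w)%:E)%E.
Proof. by move=> iX; rewrite unlock /Rintegral fineK// integrable_fin_num. Qed.

Lemma variance_affine_centered (R : realType) (dT : measure_display)
  (Omega : measurableType dT) (P : probability Omega R) (k a : R)
  (N : Omega -> R) :
  centered P N -> rintegrable P (fun w => N w ^+ 2) ->
  ('V_P[(fun w => k + a * N w)%R] = (a ^+ 2 * \int[P]_w N w ^+ 2)%R%:E)%E.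
Proof.
move=> [iN N0] iN2.
have iaN := rintegrableZ a iN.
have E : ('E_P[(fun w => k + a * N w)%R] = k%:E)%E.
  rewrite expectationE; last first.
    by apply: rintegrableD => //; exact: rintegrable_cst.
  rewrite RintegralD//; last exact: rintegrable_cst.
  by rewrite Rintegral_probability_cst RintegralZl// N0 mulr0 addr0.
rewrite /variance covariance.unlock E -RintegralZl// -expectationE; last first.
  exact: rintegrableZ.
congr ('E_P[_])%E; apply/funext => w.
transitivity ((k + a * N w - k) * (k + a * N w - k)); [by []|by ring].
Qed.

Unset Implicit Arguments.

Theorem theorem2 (R : realType) (d : nat)
  (dT : measure_display) (Omega : measurableType dT) (P : probability Omega R)
  (f : 'rV[R]_d -> R) (g : 'rV[R]_d -> 'rV[R]_d) (L M : R) (xstar : 'rV[R]_d)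
  (gamma : nat -> R) (x : nat -> Omega -> 'rV[R]_d)
  (eps : nat -> Omega -> 'rV[R]_d) (T : nat) :
  (* f convex, differentiable, with gradient g which is L-Lipschitz *)
  convex_fun f ->
  (forall y, differentiable f y) ->
  (forall y v, 'D_v f y = dotv (g y) v) ->
  0 < L ->
  (forall y z, enorm (g y - g z) <= L * enorm (y - z)) ->
  (* xstar is a minimizer *)
  (forall y, f xstar <= f y) ->
  (* iterates x_{t+1} = x_t - gamma_t gbar_t, with gbar_t = g(x_t) + eps_t,
     started from a deterministic point *)
  (exists x0, forall w, x 0%N w = x0) ->
  (forall t w, x t.+1 w = x t w - gamma t *: (g (x t w) + eps t w)) ->
  (* the stochastic errors: random vectors, independent across times,
     mean zero, symmetric, with finite fourth moment *)
  (forall t, rvec_measurable (eps t)) ->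
  (forall n, mutually_independent P eps n) ->
  (forall t (i : 'I_d), P.-integrable setT (fun w => (eps t w ord0 i)%:E)) ->
  (forall t (i : 'I_d), ('E_P[fun w => eps t w ord0 i] = 0)%E) ->
  (forall t, symmetric_distribution P (eps t)) ->
  (forall t, P.-integrable setT (fun w => (sqnorm (eps t w) ^+ 2)%:E)) ->
  (* step sizes and boundedness of the iterates *)
  (forall t, 0 < gamma t <= L^-1) ->
  (forall t w, sqnorm (x t w - xstar) <= M ^+ 2) ->
  (0 < T)%N ->
  let S := fun w =>
    (gamma T * T%:R)^-1 * (M ^+ 2 / 2)
    + (2 * T%:R)^-1 * \sum_(1 <= t < T.+1)
         gamma t * (1 + L * gamma t) * sqnorm (eps t w)
    - T%:R^-1 * \sum_(1 <= t < T.+1)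
         dotv (eps t w) (x t w - (L * gamma t ^+ 2) *: g (x t w) - xstar) in
  let sigma2bar := ((T%:R^-1)%:E *
     \sum_(1 <= t < T.+1) 'E_P[fun w => sqnorm (eps t w)])%E in
  let eta4bar := ((T%:R^-1)%:E *
     \sum_(1 <= t < T.+1) 'E_P[fun w => (sqnorm (eps t w) ^+ 2)%R])%E in
  ('V_P[S] <= (T%:R^-1)%:E *
     ((4 * M ^+ 2)%:E * sigma2bar + ((L ^+ 2)^-1)%:E * eta4bar))%E.
Proof.
move=> _ df Dg L_gt0 gL fmin [x0 x0E] xS meps ind ieps Eeps sym iq2 gammaL xM.
move=> T_gt0.
cbv zeta; set S := (X in ('V_P[X])%E).
have eps0 t i : \int[P]_w eps t w 0 i = 0.
  by have := Eeps t i; rewrite (expectationE (ieps t i)) => -[].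
have gstar : g xstar = 0 by exact: (gradient_at_min (df xstar)).
(* The Lipschitz bound is applied between [x t w] and [xstar], where the gradient vanishes. *)
have gM t w : sqnorm (g (x t w)) <= L ^+ 2 * M ^+ 2.
  have := gL (x t w) xstar; rewrite gstar subr0 => h.
  apply: (@le_trans _ _ (L ^+ 2 * sqnorm (x t w - xstar))).
    rewrite -!sqr_enorm -exprMn ler_pXn2r// nnegrE ?enorm_ge0//.
    by rewrite mulr_ge0 ?enorm_ge0 ?ltW.
  by rewrite ler_wpM2l ?sqr_ge0.
pose y t w := x t w - (L * gamma t ^+ 2) *: g (x t w) - xstar.
(* Both [x t w - xstar] and the gradient term have squared norm at most [M ^+ 2], the latter because
   [(L * gamma t) ^+ 4 <= 1]; [sqnormB_le] doubles each. *)
have yM t w : sqnorm (y t w) <= 4 * M ^+ 2.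
  rewrite /y addrAC (le_trans (sqnormB_le _ _))// sqnormZ.
  have /andP[g0 gL1] := gammaL t.
  have Lg1 : L * gamma t <= 1 by rewrite mulrC -ler_pdivlMr// mul1r.
  have Lg0 : 0 <= L * gamma t by rewrite mulr_ge0// ltW.
  have : (L * gamma t ^+ 2) ^+ 2 * sqnorm (g (x t w)) <= M ^+ 2.
    apply: (@le_trans _ _ ((L * gamma t ^+ 2) ^+ 2 * (L ^+ 2 * M ^+ 2))).
      by rewrite ler_wpM2l ?sqr_ge0.
    rewrite (_ : _ * _ = (L * gamma t) ^+ 4 * M ^+ 2); last by ring.
    by rewrite ler_piMl ?sqr_ge0// exprn_ile1.
  by have := xM t w; lra.
have gLip i u v : `|g u 0 i - g v 0 i| <= L * enorm (u - v).
  apply: le_trans (gL u v); have := le_coord_enorm (g u - g v) i.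
  by rewrite !mxE.
have mg t i :
    @rvec_measurable R d _ (g_sigma_algebraType (history eps t)) (x t) ->
    measurable_fun setT
      (fun w : g_sigma_algebraType (history eps t) => g (x t w) 0 i).
  move=> mx.
  exact: (lipschitz_measurable (h := fun u => g u 0 i) (ltW L_gt0) (gLip i) mx).
(* The iterate at time [t] depends only on errors strictly before [t]. The deterministic start
   settles the base case; the step uses the measurability of the Lipschitz gradient. *)
have mx t : @rvec_measurable R d _ (g_sigma_algebraType (history eps t)) (x t).
  elim: t => [|t mxt] i.
    by under eq_fun do rewrite x0E; exact: measurable_cst.
  rewrite (_ : (fun w => _) = fun w =>
      x t w 0 i - gamma t * (g (x t w) 0 i + eps t w 0 i)); last first.
    by apply/funext => w; rewrite xS !mxE.
  apply: measurable_funB; first by apply: past_measurable_funS; exact: mxt.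
  apply: measurable_funM => //; apply: measurable_funD.
    by apply: past_measurable_funS; exact: mg.
  exact: history_coord_measurable.
have my t i : measurable_fun setT
    (fun w : g_sigma_algebraType (history eps t) => y t w 0 i).
  rewrite (_ : (fun w => _) = fun w =>
      x t w 0 i - L * gamma t ^+ 2 * g (x t w) 0 i - xstar 0 i); last first.
    by apply/funext => w; rewrite !mxE.
  apply: measurable_funB => //; apply: measurable_funB; first exact: mx.
  by apply: measurable_funM => //; exact: mg.
pose c t := gamma t * (1 + L * gamma t) / 2.
pose m t := \int[P]_w sqnorm (eps t w).
pose N w := \sum_(1 <= t < T.+1) increment P eps t (c t) (y t) w.
have Nc : centered P N.
  exact: (centered_sum_increments meps ind ieps eps0 iq2 c my yM).
have [_ iN2 N2] := sum_increments_sqr meps ind ieps eps0 sym iq2 c my yM T.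
have T0 : T%:R != 0 :> R by rewrite pnatr_eq0 -lt0n.
(* Centering each [sqnorm (eps t w)] moves the deterministic sum of the [c t * m t] into the
   constant, which does not affect the variance. *)
have SE : S = fun w => ((gamma T * T%:R)^-1 * (M ^+ 2 / 2) +
    T%:R^-1 * \sum_(1 <= t < T.+1) c t * m t) + T%:R^-1 * N w.
  apply/funext => w; rewrite /S /N /increment.
  rewrite big_split /= sumrN.
  have -> : \sum_(1 <= t < T.+1) c t * (sqnorm (eps t w) - m t) =
      2^-1 * (\sum_(1 <= t < T.+1)
        gamma t * (1 + L * gamma t) * sqnorm (eps t w))
      - \sum_(1 <= t < T.+1) c t * m t.
    rewrite mulr_sumr -sumrB; apply: eq_bigr => t _; rewrite /c; ring.
  by rewrite (invfM 2) /y; ring.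
rewrite SE variance_affine_centered//.
have iq t : rintegrable P (fun w => sqnorm (eps t w)).
  apply: rintegrable_of_sqr (iq2 t).
  exact: (measurableT_comp (@measurable_sqnorm R d)
    (rvec_measurable_borel (meps t))).
under [X in (_ * (_ * (_ * X) + _))%E]eq_bigr do rewrite (expectationE (iq _)).
under [X in (_ * (_ + _ * (_ * X)))%E]eq_bigr do rewrite (expectationE (iq2 _)).
rewrite !sumEFin !(=^~ EFinM, =^~ EFinD) lee_fin.
(* Of the two factors [T^-1] in the variance, one cancels the prefactor of the bound and the other
   the averaging in both moment terms. *)
rewrite expr2 -mulrA ler_wpM2l ?invr_ge0//.
rewrite (mulrCA (4 * _)) (mulrCA (L ^+ 2)^-1) -mulrDr ler_wpM2l ?invr_ge0//.
apply: le_trans N2 _; rewrite big_split /= addrC !mulr_sumr lerD//.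
apply: ler_sum => t _; apply: ler_wpM2r.
  by apply: Rintegral_ge0 => w _; exact: sqr_ge0.
have /andP[g0 gL1] := gammaL t.
have Lg1 : L * gamma t <= 1 by rewrite mulrC -ler_pdivlMr// mul1r.
have Lg0 : 0 <= L * gamma t by rewrite mulr_ge0// ltW.
have c0 : 0 <= c t by rewrite /c divr_ge0// mulr_ge0 ?addr_ge0// ltW.
rewrite -exprVn ler_pXn2r ?nnegrE ?invr_ge0 ?(ltW L_gt0)//.
(* Since [L * gamma t <= 1], the factor [(1 + L * gamma t) / 2] is at most 1, so
   [c t <= gamma t <= L^-1]. *)
by apply: le_trans gL1; rewrite /c; nra.
Qed.
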